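(* Let $n \ge 2$, let $G \subsetneq \mathbb{R}^n$ be a domain and let $x \in G$. Then the $j$-balls $B_j(x,M)$ of $G$ are convex if $M \in (0,\log 2]$, and strictly starlike with respect to $x$ if $M \in \big(0,\log(1+\sqrt{2})\big]$.
   Context: Let $n\ge 2$ and let $G\subsetneq\mathbb{R}^n$ be a domain (a nonempty open connected set). For $x\in G$ let $d(x)$ denote the Euclidean distance from $x$ to $\partial G$. The $j$-metric on $G$ is $$j_G(x,y)=\log\left(1+\frac{|x-y|}{\min\{d(x),d(y)\}}\right),\qquad x,y\in G.$$ For $x\in G$ and $M>0$ the $j$-ball is $B_j(x,M)=\{y\in G: j_G(x,y)<M\}$. A bounded domain $D\subset\mathbb{R}^n$ is called strictly starlike with respect to a point $x\in D$ if each ray from $x$ meets $\partial D$ at exactly one point. *)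

(* Defs.v *)
From mathcomp Require Import all_boot all_order all_algebra.
From mathcomp Require Import all_classical all_reals all_analysis.
Set Implicit Arguments.
Unset Strict Implicit.
Unset Printing Implicit Defensive.
Import Order.TTheory GRing.Theory Num.Theory.
Import numFieldNormedType.Exports.
Local Open Scope classical_set_scope.
Local Open Scope ring_scope.

(* The library norm `|v| on 'rV[R]_n is the max norm. It induces the usual
   topology and the usual bounded sets of R^n, but distances have to be
   measured with the Euclidean norm defined here. *)
Definition enorm (R : realType) (n : nat) (v : 'rV[R]_n) : R :=
  Num.sqrt (\sum_(i < n) v 0 i ^+ 2).

Definition boundary (T : topologicalType) (A : set T) : set T :=
  closure A `\` interior A.

Definition domain (T : topologicalType) (A : set T) : Prop :=
  [/\ A !=set0, open A & connected A].

Definition bdist (R : realType) (n : nat) (G : set 'rV[R]_n) (x : 'rV[R]_n) : R :=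
  inf [set enorm (x - z) | z in boundary G].

(* Meaningful for x, y in G. *)
Definition jmetric (R : realType) (n : nat) (G : set 'rV[R]_n)
    (x y : 'rV[R]_n) : R :=
  ln (1 + enorm (x - y) / Num.min (bdist G x) (bdist G y)).

Definition jball (R : realType) (n : nat) (G : set 'rV[R]_n)
    (x : 'rV[R]_n) (M : R) : set 'rV[R]_n :=
  [set y | G y /\ jmetric G x y < M].

Definition ray (R : realType) (n : nat) (x u : 'rV[R]_n) : set 'rV[R]_n :=
  [set x + t *: u | t in [set t : R | 0 <= t]].

Definition strictly_starlike (R : realType) (n : nat) (D : set 'rV[R]_n)
    (x : 'rV[R]_n) : Prop :=
  [/\ domain D, bounded_set D, D x &
    forall u : 'rV[R]_n, u != 0 -> exists! y, (ray x u `&` boundary D) y].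

(* Main.v *)
Require Import Defs.
From mathcomp Require Import all_boot all_order all_algebra.
From mathcomp Require Import all_classical all_reals all_analysis.
From mathcomp Require Import ring lra.
Import Order.TTheory GRing.Theory Num.Theory.
Import numFieldNormedType.Exports.
Local Open Scope classical_set_scope.
Local Open Scope ring_scope.

(** Write |.| for the Euclidean norm, d for the distance to the boundary of G,
    and r = e^M - 1.  Then y in G lies in the j-ball exactly when
    |x - y| < r d(x) and |x - y| < r d(y) ([jballP]).  The bounds on M say
    r <= 1 for the first claim and r <= sqrt 2 for the second.  Both claims
    follow from Stewart's identity ([stewart]) for the distance from a point z
    to a point dividing a segment, applied to every z of the boundary of G.

    Convexity.  For k <= 1 the function |y - x|^2 - k^2 |y - z|^2 of y is
    convex, so that { y : |x - y| <= k |y - z| } is a ball, a half-space or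
    the whole space, and is convex ([apollonius_convex]).  Two given points of
    the j-ball satisfy |x - y| <= k d(y) with a common k < r; this inequality
    passes to the points between them by taking the infimum over z, and it is
    stronger than |x - y| < r d(y).  The condition |x - y| < r d(x) defines a
    ball.

    Starlikeness.  It is enough that every point y of the closure of the
    j-ball sees x along a segment whose points other than y are in the (open)
    j-ball ([jball_half_open_segment], [strictly_starlikeI]).  Put
    c = |x - y| / r.  Then x and y are at distance at least c from each
    boundary point z, and |x - y|^2 <= 2 c^2, so by Stewart the point at
    parameter t < 1 has distance at least c sqrt (1 - 2 t (1 - t)) from z
    ([seg_far]).  For y other than x this is larger than c t = t |x - y| / r
    because 1 - 2 t (1 - t) - t^2 = (1 - t)^2.

    Membership in G of the intermediate points comes from the fact that the
    open balls of radius d(x) and d(y) around x and y lie in G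
    ([lt_bdist_in]).  For r <= 1 the first of them contains the j-ball; for
    r < 2 both together cover the segment from x to y ([seg_sub]). *)

(** * The Euclidean norm *)

Section EuclideanNorm.
Context {R : realType} {n : nat}.
Implicit Types u v p q z : 'rV[R]_n.

Lemma sum_sqr_ge0 v : 0 <= \sum_(i < n) v 0 i ^+ 2.
Proof. by apply: sumr_ge0 => i _; exact: sqr_ge0. Qed.

Lemma enorm_sqr v : enorm v ^+ 2 = \sum_(i < n) v 0 i ^+ 2.
Proof. by rewrite /enorm sqr_sqrtr // sum_sqr_ge0. Qed.

Lemma enorm_ge0 v : 0 <= enorm v.
Proof. exact: sqrtr_ge0. Qed.

Lemma enormZ a v : enorm (a *: v) = `|a| * enorm v.
Proof.
rewrite /enorm -sqrtr_sqr -sqrtrM ?sqr_ge0 // mulr_sumr.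
by congr Num.sqrt; apply: eq_bigr => i _; rewrite !mxE exprMn.
Qed.

Lemma enormN v : enorm (- v) = enorm v.
Proof. by rewrite -scaleN1r enormZ normrN1 mul1r. Qed.

Lemma enorm_distC u v : enorm (u - v) = enorm (v - u).
Proof. by rewrite -enormN opprB. Qed.

Lemma coord_le_enorm v i : `|v 0 i| <= enorm v.
Proof.
rewrite -sqrtr_sqr ler_wsqrtr // (bigD1 i) //= lerDl.
by apply: sumr_ge0 => j _; exact: sqr_ge0.
Qed.

Lemma normr_le_enorm v : `|v| <= enorm v.
Proof.
have [->|v0] := eqVneq v 0; first by rewrite normr0 enorm_ge0.
have /mx_norm_neq0[[i j] /= vE] : mx_norm v != 0.
  by apply: contra v0 => /eqP/mx_norm_eq0 ->.
by rewrite -/(mx_norm v) vE (ord1 i) coord_le_enorm.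
Qed.

Lemma enorm_eq0 v : enorm v = 0 -> v = 0.
Proof.
by move=> v0; apply/eqP; rewrite -normr_le0 -v0 normr_le_enorm.
Qed.

Lemma enorm0 : enorm (0 : 'rV[R]_n) = 0.
Proof. by rewrite -(scale0r 0) enormZ normr0 mul0r. Qed.

(** Expand the square of the Euclidean norm of |v| u - |u| v. *)
Lemma cauchy_schwarz u v : \sum_(i < n) u 0 i * v 0 i <= enorm u * enorm v.
Proof.
have [/eqP/enorm_eq0->|u0] := boolP (enorm u == 0).
  by rewrite big1 ?mulr_ge0 ?enorm_ge0 // => i _; rewrite mxE mul0r.
have [/eqP/enorm_eq0->|v0] := boolP (enorm v == 0).
  by rewrite big1 ?mulr_ge0 ?enorm_ge0 // => i _; rewrite mxE mulr0.
have uv0 : 0 < enorm u * enorm v *+ 2.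
  by rewrite pmulrn_lgt0 // mulr_gt0 // lt_def ?u0 ?v0 enorm_ge0.
rewrite -subr_ge0 -(pmulr_rge0 _ uv0).
suff -> : enorm u * enorm v *+ 2 *
    (enorm u * enorm v - \sum_(i < n) u 0 i * v 0 i) =
    enorm (enorm v *: u - enorm u *: v) ^+ 2 by exact: sqr_ge0.
transitivity (enorm v ^+ 2 * (enorm u ^+ 2) + enorm u ^+ 2 * (enorm v ^+ 2)
    - (enorm u * enorm v *+ 2) * \sum_(i < n) u 0 i * v 0 i).
  by ring.
rewrite [in X in X + _ - _](enorm_sqr u) [in X in _ + X - _](enorm_sqr v).
rewrite [RHS]enorm_sqr !mulr_sumr -big_split -sumrB; apply: eq_bigr => i _ /=.
by rewrite !mxE; ring.
Qed.

Lemma enormD u v : enorm (u + v) <= enorm u + enorm v.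
Proof.
rewrite -(ler_pXn2r (n := 2)) ?nnegrE ?addr_ge0 ?enorm_ge0 //.
rewrite sqrrD !enorm_sqr.
under eq_bigr do rewrite mxE sqrrD.
by rewrite !big_split /= lerD2r lerD2l -mulr2n lerMn2r cauchy_schwarz orbT.
Qed.

Lemma enorm_continuous : continuous (@enorm R n).
Proof.
pose sqs (w : 'rV[R]_n) := \sum_(i < n) w 0 i ^+ 2.
move=> v; apply: (@continuous_comp _ _ _ sqs Num.sqrt).
  apply: continuous_big => [|i _ w]; first exact: add_continuous.
  apply: (@continuous_comp _ _ _ (fun w : 'rV[R]_n => w 0 i) (fun a => a ^+ 2)).
    exact: coord_continuous.
  exact: exprn_continuous.
exact: sqrt_continuous.
Qed.

(** Each coordinate of a point of the segment from p to q is an affine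
    function of t, and subtracting the chord from the square of an affine
    function leaves - t (1 - t) times the square of its slope. *)
Lemma stewart p q z t :
  enorm (p + t *: (q - p) - z) ^+ 2 =
  (1 - t) * enorm (p - z) ^+ 2 + t * enorm (q - z) ^+ 2
    - t * (1 - t) * enorm (p - q) ^+ 2.
Proof.
rewrite !enorm_sqr !mulr_sumr -big_split -sumrB; apply: eq_bigr => i _ /=.
by rewrite !mxE; ring.
Qed.

Lemma enorm_dist_continuous p : continuous (fun q => enorm (p - q)).
Proof.
move=> q; apply: continuous_comp; last exact: enorm_continuous.
by apply: (@cvgB _ _ _ _ (nbhs_filter q)); [exact: cvg_cst|exact: cvg_id].
Qed.

End EuclideanNorm.

(** * Segments and boundaries *)

(** If S missed the boundary of A, then the interior and the closure of A
    would have the same trace on S, which would be both open and closed in S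
    without being empty or equal to S. *)
Lemma connected_meets_boundary {T : topologicalType} (S A : set T) :
  connected S -> S `&` A !=set0 -> S `\` A !=set0 ->
  S `&` boundary A !=set0.
Proof.
move=> cS [a [Sa Aa]] [b [Sb nAb]]; apply: contrapT => noB.
have SE : S `&` interior A = S `&` closure A.
  apply/seteqP; split=> y [Sy Ay]; split=> //.
    by apply: subset_closure; exact: interior_subset.
  by apply: contrapT => nAy; apply: noB; exists y.
have SC : S `&` closure A = S.
  apply: cS.
  - by exists a; split=> //; exact: subset_closure.
  - by exists (interior A); [exact: open_interior|rewrite SE].
  - by exists (closure A); [exact: closed_closure|].
by move: Sb; rewrite -{1}SC -SE => -[_ /interior_subset].
Qed.

Section Segments.
Context {R : realType} {n : nat}.
Implicit Types (p q x y z : 'rV[R]_n) (A : set 'rV[R]_n).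

Definition seg p q : set 'rV[R]_n := [set p + t *: (q - p) | t in `[0, 1]].

Lemma seg_connected p q : connected (seg p q).
Proof.
apply: connected_continuous_connected; first exact: segment_connected.
apply: continuous_subspaceT => t.
by apply: cvgD; [exact: cvg_cst|apply: cvgZr_tmp; exact: cvg_id].
Qed.

Lemma seg_left p q : seg p q p.
Proof. by exists 0; rewrite ?scale0r ?addr0 //= in_itv /= lexx ler01. Qed.

Lemma seg_right p q : seg p q q.
Proof. by exists 1; rewrite ?scale1r ?subrKC //= in_itv /= lexx ler01. Qed.

Lemma seg_meets_boundary A p q : A p -> ~ A q ->
  exists2 t, 0 <= t <= 1 & boundary A (p + t *: (q - p)).
Proof.
move=> Ap nAq.
have [||z [[t /= t01 <-] bz]] :=
    connected_meets_boundary (seg p q) A (seg_connected p q).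
- by exists p; split=> //; exact: seg_left.
- by exists q; split=> //; exact: seg_right.
- by exists t => //; move: t01; rewrite in_itv.
Qed.

Lemma enorm_seg_left p q t :
  enorm (p - (p + t *: (q - p))) = `|t| * enorm (p - q).
Proof. by rewrite opprD addNKr enormN enormZ enorm_distC. Qed.

Lemma enorm_seg_right p q t :
  enorm (q - (p + t *: (q - p))) = `|1 - t| * enorm (p - q).
Proof.
by rewrite (enorm_distC p) -enormZ scalerBl scale1r opprD addrA.
Qed.

End Segments.

(** * Distance to the boundary *)

Section BoundaryDistance.
Context {R : realType} {n : nat} (G : set 'rV[R]_n).
Hypotheses (oG : open G) (G0 : G !=set0) (GC : ~` G !=set0).
Implicit Types (p q x y z : 'rV[R]_n).

(** The infimum of the empty set is 0 by convention, so lower bounds for the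
    distance to the boundary require the boundary to be nonempty. *)
Lemma boundary_neq0 : boundary G !=set0.
Proof.
have [[a Ga] [b nGb]] := (G0, GC).
by have [t _ bt] := seg_meets_boundary G a b Ga nGb; exists (a + t *: (b - a)).
Qed.

Lemma bdist_le x z : boundary G z -> bdist G x <= enorm (x - z).
Proof.
move=> bz; apply: ge_inf; last by exists z.
by exists 0 => _ [w _ <-]; exact: enorm_ge0.
Qed.

Lemma le_bdist x c : (forall z, boundary G z -> c <= enorm (x - z)) ->
  c <= bdist G x.
Proof.
move=> cx; apply: lb_le_inf; last by move=> _ [z bz <-]; exact: cx.
by have [z bz] := boundary_neq0; exists (enorm (x - z)); exists z.
Qed.

Lemma bdist_lipschitz x y : bdist G x <= bdist G y + enorm (x - y).
Proof.
rewrite -lerBlDr; apply: le_bdist => z bz; rewrite lerBlDr.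
apply: le_trans (bdist_le x z bz) _.
by rewrite -[x - z](subrKA y) addrC enormD.
Qed.

Lemma bdist_continuous : continuous (bdist G).
Proof.
move=> x; apply/(@cvgrPdist_lt _ _ _ (nbhs x) (nbhs_filter x)) => e e0.
have := enorm_dist_continuous x x.
rewrite /continuous_at subrr enorm0.
move=> /(@cvgrPdist_lt _ _ _ (nbhs x) (nbhs_filter x))/(_ e e0).
apply: (@filterS _ (nbhs x)) => y /=.
rewrite sub0r normrN ger0_norm ?enorm_ge0 //; apply: le_lt_trans.
have := bdist_lipschitz x y; have := bdist_lipschitz y x.
rewrite (enorm_distC y x) => h1 h2.
by rewrite ler_norml; apply/andP; split; lra.
Qed.

(** The topology is given by the maximum norm, which the Euclidean norm
    dominates: boundary points lie outside a maximum-norm ball contained in G,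
    hence also outside the Euclidean ball of the same radius. *)
Lemma bdist_gt0 x : G x -> 0 < bdist G x.
Proof.
move=> Gx; have /nbhs_ballP[e /= e0 eG] : nbhs x G by exact: open_nbhs_nbhs.
apply: lt_le_trans e0 _; apply: le_bdist => z [_ nGz].
apply: le_trans (normr_le_enorm _); rewrite leNgt; apply/negP => xze.
apply: nGz; rewrite (proj1 (interior_id G) oG); apply: eG.
by rewrite -ball_normE.
Qed.

(** Otherwise the segment from x to y would meet the boundary of G at a point
    no farther from x than y. *)
Lemma lt_bdist_in x y : G x -> enorm (x - y) < bdist G x -> G y.
Proof.
move=> Gx xy; apply: contrapT => nGy.
have [t t01 bt] := seg_meets_boundary G x y Gx nGy.
move: (bdist_le x _ bt); rewrite enorm_seg_left leNgt => /negP; apply.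
apply: le_lt_trans xy; rewrite ger0_norm ?ler_piMl ?enorm_ge0 //; lra.
Qed.

(** The ball around p of radius d(p) and the ball around q of radius d(q)
    together cover the segment. *)
Lemma seg_sub p q t : G p -> G q ->
  enorm (p - q) < bdist G p + bdist G q -> 0 <= t <= 1 ->
  G (p + t *: (q - p)).
Proof.
move=> Gp Gq pq /andP[t0 t1].
have [tp|tp] := ltP (t * enorm (p - q)) (bdist G p).
  by apply: (lt_bdist_in p) => //; rewrite enorm_seg_left ger0_norm.
apply: (lt_bdist_in q) => //; rewrite enorm_seg_right ger0_norm ?subr_ge0 //.
lra.
Qed.

End BoundaryDistance.

(** * Consequences of Stewart's identity *)

Section Stewart.
Context {R : realType} {n : nat}.
Implicit Types (p q x y z : 'rV[R]_n).

(** By Stewart's identity, |y - x|^2 - k^2 |y - z|^2 lies below its chord at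
    an intermediate point by t (1 - t) (1 - k^2) |p - q|^2, which is
    nonnegative since k <= 1. *)
Lemma apollonius_convex x z p q k t : 0 <= k <= 1 -> 0 <= t <= 1 ->
  enorm (p - x) <= k * enorm (p - z) -> enorm (q - x) <= k * enorm (q - z) ->
  enorm (p + t *: (q - p) - x) <= k * enorm (p + t *: (q - p) - z).
Proof.
move=> /andP[k0 k1] /andP[t0 t1] px qx.
have sq v : enorm (v - x) <= k * enorm (v - z) <->
    enorm (v - x) ^+ 2 <= k ^+ 2 * enorm (v - z) ^+ 2.
  by rewrite -exprMn ler_pXn2r ?nnegrE ?mulr_ge0 ?enorm_ge0.
apply/sq; move/sq in px; move/sq in qx; rewrite !stewart.
have k2 : 0 <= 1 - k ^+ 2 by rewrite subr_ge0 expr_le1.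
have tt : 0 <= t * (1 - t) by rewrite mulr_ge0 // subr_ge0.
have h1 := mulr_ge0 (mulr_ge0 k2 tt) (sqr_ge0 (enorm (p - q))).
have h2 : 0 <= (1 - t) * (k ^+ 2 * enorm (p - z) ^+ 2 - enorm (p - x) ^+ 2).
  by rewrite mulr_ge0 // subr_ge0.
have h3 : 0 <= t * (k ^+ 2 * enorm (q - z) ^+ 2 - enorm (q - x) ^+ 2).
  by rewrite mulr_ge0 // subr_ge0.
lra.
Qed.

Lemma enorm_seg_le x p q t : 0 <= t <= 1 ->
  enorm (x - (p + t *: (q - p))) <= Num.max (enorm (x - p)) (enorm (x - q)).
Proof.
move=> /andP[t0 t1]; set m := Num.max _ _.
have -> : x - (p + t *: (q - p)) = (1 - t) *: (x - p) + t *: (x - q).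
  by apply/rowP => i; rewrite !mxE; ring.
apply: le_trans (enormD _ _) _; rewrite !enormZ !ger0_norm ?subr_ge0 //.
have -> : m = (1 - t) * m + t * m by ring.
by rewrite lerD // ler_wpM2l ?subr_ge0 // le_max lexx ?orbT.
Qed.

(** If both ends of a segment are at distance at least c from z, the segment
    can come closer to z only in so far as it is long; here its length is at
    most c sqrt 2. *)
Lemma seg_far x y z c t : 0 <= c -> 0 <= t <= 1 ->
  enorm (x - y) ^+ 2 <= 2 * c ^+ 2 ->
  c <= enorm (x - z) -> c <= enorm (y - z) ->
  (1 - t * (1 - t) * 2) * c ^+ 2 <= enorm (x + t *: (y - x) - z) ^+ 2.
Proof.
move=> c0 /andP[t0 t1] xy xz yz; rewrite stewart.
have h v : c <= enorm (v - z) -> c ^+ 2 <= enorm (v - z) ^+ 2.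
  by rewrite ler_pXn2r ?nnegrE ?enorm_ge0.
have t1' : 0 <= 1 - t by rewrite subr_ge0.
have h1 : 0 <= (1 - t) * (enorm (x - z) ^+ 2 - c ^+ 2).
  by rewrite mulr_ge0 // subr_ge0 h.
have h2 : 0 <= t * (enorm (y - z) ^+ 2 - c ^+ 2).
  by rewrite mulr_ge0 // subr_ge0 h.
have h3 : 0 <= t * (1 - t) * (2 * c ^+ 2 - enorm (x - y) ^+ 2).
  by rewrite mulr_ge0 ?mulr_ge0 // subr_ge0.
lra.
Qed.

End Stewart.

(** * Balls of the j-metric *)

Section JBall.
Context {R : realType} {n : nat} (G : set 'rV[R]_n).
Hypotheses (oG : open G) (G0 : G !=set0) (GC : ~` G !=set0).
Context (x : 'rV[R]_n) (Gx : G x) (M : R) (M0 : 0 < M).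
Let r := expR M - 1.
Let d := bdist G.

Let dpos y : G y -> 0 < d y.
Proof. exact: bdist_gt0. Qed.

Let r_gt0 : 0 < r.
Proof. by rewrite subr_gt0 expR_gt1. Qed.

Lemma jballP y : jball G x M y <->
  [/\ G y, enorm (x - y) < r * d x & enorm (x - y) < r * d y].
Proof.
rewrite /jball /jmetric /= -/(d x) -/(d y).
split=> [[Gy]|[Gy xr yr]].
  have m0 : 0 < Num.min (d x) (d y) by rewrite lt_min !dpos.
  have e0 := divr_ge0 (enorm_ge0 (x - y)) (ltW m0).
  rewrite -ltr_expR lnK ?posrE ?ltr_wpDr // -ltrBrDl ltr_pdivrMr // -/r => xy.
  by split=> //; apply: (lt_le_trans xy); rewrite ler_pM2l // ge_min lexx ?orbT.
have m0 : 0 < Num.min (d x) (d y) by rewrite lt_min !dpos.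
have e0 := divr_ge0 (enorm_ge0 (x - y)) (ltW m0).
split=> //; rewrite -ltr_expR lnK ?posrE ?ltr_wpDr // -ltrBrDl.
by rewrite ltr_pdivrMr // -/r minElt; case: ifP.
Qed.

Lemma jball_center : jball G x M x.
Proof. by apply/jballP; rewrite subrr enorm0 mulr_gt0 ?dpos. Qed.

Lemma jball_convex : r <= 1 -> convex_set (jball G x M).
Proof.
move=> r1 p q l; rewrite !inE => /jballP[Gp px pd] /jballP[Gq qx qd].
have -> : convex.conv l p q = q + l%:num *: (p - q) :> 'rV[R]_n.
  rewrite /convex.conv /= /unstable.onem scalerBl scalerBr scale1r.
  by rewrite addrC addrAC addrA.
have l01 : 0 <= l%:num <= 1 by apply/andP; split.
set t := l%:num in l01 *; set y := q + t *: (p - q).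
have dp := dpos p Gp; have dq := dpos q Gq; have dx := dpos x Gx.
have yx : enorm (x - y) < r * d x.
  by apply: le_lt_trans (enorm_seg_le x q p t l01) _; rewrite gt_max qx px.
have Gy : G y.
  apply: (lt_bdist_in G x) => //; apply: lt_le_trans yx _.
  by rewrite ler_piMl // ltW.
(* A single ratio k < r for both ends keeps the inequality at y strict after
   passing to the infimum over the boundary. *)
pose k := Num.max (enorm (x - p) / d p) (enorm (x - q) / d q).
have kr : k < r by rewrite gt_max !ltr_pdivrMr // pd qd.
have k0 : 0 <= k by rewrite le_max divr_ge0 ?enorm_ge0 // ltW.
have kp : enorm (x - p) <= k * d p by rewrite -ler_pdivrMr // le_max lexx.
have kq : enorm (x - q) <= k * d q by rewrite -ler_pdivrMr // le_max lexx orbT.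
have yk : enorm (x - y) <= k * d y.
  (* The case k = 0, where dividing by k is impossible, forces p = q = x. *)
  have [k00|kn0] := eqVneq k 0.
    have /enorm_eq0/subr0_eq xp : enorm (x - p) = 0.
      by apply/eqP; rewrite eq_le enorm_ge0 andbT (le_trans kp) // k00 mul0r.
    have /enorm_eq0/subr0_eq xq : enorm (x - q) = 0.
      by apply/eqP; rewrite eq_le enorm_ge0 andbT (le_trans kq) // k00 mul0r.
    by rewrite /y -xp -xq subrr scaler0 addr0 subrr enorm0 k00 mul0r.
  have kpos : 0 < k by rewrite lt_def kn0.
  rewrite mulrC -ler_pdivrMr //; apply: le_bdist => // z bz.
  rewrite ler_pdivrMr // mulrC (enorm_distC x) /y.
  apply: apollonius_convex => //.
  - by rewrite k0 (le_trans (ltW kr)).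
  - rewrite enorm_distC; apply: le_trans kq _.
    by rewrite ler_wpM2l //; exact: bdist_le.
  - rewrite enorm_distC; apply: le_trans kp _.
    by rewrite ler_wpM2l //; exact: bdist_le.
by apply/jballP; split=> //; apply: (le_lt_trans yk); rewrite ltr_pM2r ?dpos.
Qed.

Let rd_continuous : continuous (fun y => r * d y).
Proof.
move=> y; apply: (@cvgM _ _ _ (nbhs_filter y)).
  exact: cvg_cst.
exact: bdist_continuous.
Qed.

Let gap_x_continuous : continuous (fun y : 'rV[R]_n => r * d x - enorm (x - y)).
Proof.
move=> y; apply: (@cvgB _ _ _ _ (nbhs_filter y)); first exact: cvg_cst.
exact: enorm_dist_continuous.
Qed.

Let gap_y_continuous : continuous (fun y : 'rV[R]_n => r * d y - enorm (x - y)).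
Proof.
move=> y; apply: (@cvgB _ _ _ _ (nbhs_filter y)); first exact: rd_continuous.
exact: enorm_dist_continuous.
Qed.

Lemma jball_open : open (jball G x M).
Proof.
have -> : jball G x M = G `&`
    ((fun y => r * d x - enorm (x - y)) @^-1` [set t | 0 < t] `&`
     (fun y => r * d y - enorm (x - y)) @^-1` [set t | 0 < t]).
  apply/seteqP; split=> y.
    by move=> /jballP[? ? ?]; split=> //; split; rewrite /= subr_gt0.
  by move=> [? [/=]]; rewrite !subr_gt0 => ? ?; apply/jballP.
apply: openI => //; apply: openI; apply: open_comp; try exact: open_gt.
  by move=> y _; exact: gap_x_continuous.
by move=> y _; exact: gap_y_continuous.
Qed.

Lemma jball_bounded : bounded_set (jball G x M).
Proof.
exists (r * d x + `|x|); split; first exact: num_real.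
move=> N /ltW xN y /jballP[_ yx _] /=; apply: le_trans xN.
rewrite -[y](subKr x) (le_trans (ler_normB _ _)) // addrC lerD2r.
exact: le_trans (normr_le_enorm _) (ltW yx).
Qed.

(** The non-strict inequalities pass to the limit by continuity of d.  A limit
    point y outside G would be on the boundary, where d(y) <= 0, so the second
    inequality would give y = x, which is in G. *)
Lemma closure_jball y : closure (jball G x M) y ->
  [/\ G y, enorm (x - y) <= r * d x & enorm (x - y) <= r * d y].
Proof.
move=> cy.
have cl (f : 'rV[R]_n -> R) : continuous f ->
    jball G x M `<=` [set z | 0 <= f z] -> 0 <= f y.
  move=> cf /closureS /(_ y cy).
  suff /[apply] : closed [set z | 0 <= f z] by [].
  apply: (@closed_comp _ _ f [set a | 0 <= a]); last exact: closed_ge.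
  by move=> z _; exact: cf.
have yx : enorm (x - y) <= r * d x.
  rewrite -subr_ge0; apply: (cl _ gap_x_continuous).
  by move=> z /jballP[_ zx _]; rewrite /= subr_ge0 ltW.
have yd : enorm (x - y) <= r * d y.
  rewrite -subr_ge0; apply: (cl _ gap_y_continuous).
  by move=> z /jballP[_ _ zx]; rewrite /= subr_ge0 ltW.
split=> //; apply: contrapT => nGy.
have bGy : boundary G y.
  split; last by move=> /interior_subset.
  by apply: closureS cy => z [].
have dy0 : d y <= 0 by have := bdist_le G y y bGy; rewrite subrr enorm0.
apply: nGy; suff /subr0_eq <- : x - y = 0 by [].
apply: enorm_eq0; apply/eqP; rewrite eq_le enorm_ge0 andbT (le_trans yd) //.
by rewrite pmulr_rle0.
Qed.

(** With c = |x - y| / r, Stewart's identity bounds the distance to the boundary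
    below by c sqrt (1 - r^2 t (1 - t)).  This exceeds c t if and only if
    r^2 t < 1 + t, which is true for all t < 1 exactly when r^2 <= 2. *)
Lemma jball_half_open_segment y t : r ^+ 2 <= 2 -> closure (jball G x M) y ->
  0 <= t < 1 -> jball G x M (x + t *: (y - x)).
Proof.
move=> r2 /closure_jball[Gy yx yd] /andP[t0 t1].
have dx := dpos x Gx; have dy := dpos y Gy.
have [/enorm_eq0/subr0_eq <-|xy0] := eqVneq (enorm (x - y)) 0.
  by rewrite subrr scaler0 addr0; exact: jball_center.
set rho := enorm (x - y) in yx yd xy0.
have rho0 : 0 < rho by rewrite lt_def xy0 enorm_ge0.
pose c := rho / r.
have c0 : 0 < c by rewrite divr_gt0.
have cx : c <= d x by rewrite ler_pdivrMr // mulrC.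
have cy : c <= d y by rewrite ler_pdivrMr // mulrC.
have rhoE : rho = r * c by rewrite /c mulrC divfK // gt_eqF.
have r_lt2 : r < 2.
  by rewrite -(ltr_pXn2r (n := 2)) ?nnegrE ?(ltW r_gt0) //; lra.
have t01 : 0 <= t <= 1 by rewrite t0 ltW.
have Gt : G (x + t *: (y - x)).
  apply: seg_sub => //; rewrite -/rho rhoE.
  by apply: (lt_le_trans _ (lerD cx cy)); nra.
apply/jballP; rewrite enorm_seg_left ger0_norm // -/rho; split=> //.
  by apply: lt_le_trans yx; rewrite gtr_pMl.
pose s := Num.sqrt (1 - t * (1 - t) * 2).
have s2 : s ^+ 2 = 1 - t * (1 - t) * 2.
  by rewrite sqr_sqrtr //; nra.
have s0 : 0 <= s by exact: sqrtr_ge0.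
have sd : s * c <= d (x + t *: (y - x)).
  apply: le_bdist => // z bz.
  rewrite -(ler_pXn2r (n := 2)) ?nnegrE ?enorm_ge0 ?(mulr_ge0 s0 (ltW c0)) //.
  rewrite exprMn s2; apply: seg_far => //; first exact: ltW.
  - by rewrite -/rho rhoE exprMn ler_wpM2r ?sqr_ge0.
  - by apply: le_trans cx _; exact: bdist_le.
  - by apply: le_trans cy _; exact: bdist_le.
have ts : t < s.
  rewrite -(ltr_pXn2r (n := 2)) ?nnegrE // s2; nra.
apply: (@lt_le_trans _ _ (r * (s * c))); last by rewrite ler_pM2l.
by rewrite rhoE mulrCA ltr_pM2l // ltr_pM2r.
Qed.

End JBall.

(** * Strict starlikeness *)

(** Being a union of segments from x, D is connected.  A ray leaves the
    bounded set D, hence meets the boundary; of two boundary points on a ray,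
    the nearer one would be in D, and D is its own interior. *)
Lemma strictly_starlikeI {R : realType} {n : nat} (D : set 'rV[R]_n) x :
  open D -> bounded_set D -> D x ->
  (forall y t, closure D y -> 0 <= t < 1 -> D (x + t *: (y - x))) ->
  strictly_starlike D x.
Proof.
move=> oD bD Dx star; split=> //.
  split=> //; first by exists x.
  have -> : D = \bigcup_(y in D) seg x y.
    apply/seteqP; split=> [y Dy|_ [y Dy [t /= t01 <-]]].
      by exists y => //; exact: seg_right.
    have [->|t1] := eqVneq t 1; first by rewrite scale1r subrKC.
    apply: star; first exact: subset_closure.
    by move: t01; rewrite in_itv /= lt_neqAle t1 => /andP[-> ->].
  apply: bigcup_connected; last by move=> y _; exact: (seg_connected x y).
  by exists x => y _; exact: seg_left.
move=> u u0.
(* A point of the ray outside D: parameters beyond (K + |x|) / |u| work when K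
   bounds D. *)
have [w [t0 t00 wE] nDw] :
    exists2 w, exists2 t, 0 <= t & w = x + t *: u & ~ D w.
  apply: contrapT => nw.
  have Dt t : 0 <= t -> D (x + t *: u).
    move=> t0; apply: contrapT => nD; apply: nw.
    by exists (x + t *: u); first exists t.
  have [N [_ /(_ (`|N| + 1))]] := bD.
  rewrite (le_lt_trans (ler_norm N)) ?ltrDl // => /(_ isT) bN.
  set K := `|N| + 1 in bN.
  have K0 : 0 <= K by rewrite addr_ge0.
  have un : 0 < `|u| by rewrite normr_gt0.
  pose t := (K + `|x| + 1) / `|u|.
  have t0 : 0 <= t by rewrite divr_ge0 // !addr_ge0.
  have := bN _ (Dt t t0) => /=.
  apply/negP; rewrite -ltNge.
  have : `|t *: u| <= `|x + t *: u| + `|x|.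
    by rewrite -[in leLHS](addKr x (t *: u)) addrC (le_trans (ler_normB _ _)).
  rewrite normrZ ger0_norm // /t divfK ?gt_eqF //; lra.
have [s /andP[s0 s1] bs] := seg_meets_boundary D x w Dx nDw.
have bs' : boundary D (x + (s * t0) *: u).
  by move: bs; rewrite wE addrAC subrr add0r scalerA.
have no_two a b : 0 <= a -> a < b -> boundary D (x + a *: u) ->
    boundary D (x + b *: u) -> False.
  move=> a0 ab [_ nDa] [cDb _]; apply: nDa.
  rewrite (proj1 (interior_id D) oD).
  have b0 : 0 < b by exact: le_lt_trans ab.
  have -> : x + a *: u = x + (a / b) *: (x + b *: u - x).
    by rewrite addrAC subrr add0r scalerA divfK // gt_eqF.
  by apply: star => //; rewrite divr_ge0 ?(ltW b0) //= ltr_pdivrMr // mul1r.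
exists (x + (s * t0) *: u); split.
  by split=> //; exists (s * t0) => //=; rewrite mulr_ge0.
move=> _ [[b /= b0 <-] bb].
have [ab|ba|->//] := ltgtP (s * t0) b.
- by case: (no_two _ _ (mulr_ge0 s0 t00) ab bs' bb).
- by case: (no_two _ _ b0 ba bb bs').
Qed.

Theorem theorem1p1 (R : realType) (n : nat) (hn : (2 <= n)%N)
    (G : set 'rV[R]_n) (domG : domain G) (properG : G `<` [set: 'rV[R]_n])
    (x : 'rV[R]_n) (Gx : G x) :
  (forall M : R, 0 < M <= ln 2 -> convex_set (jball G x M)) /\
  (forall M : R, 0 < M <= ln (1 + Num.sqrt 2) ->
     strictly_starlike (jball G x M) x).
Proof.
have [G0 oG _] := domG.
have GC : ~` G !=set0.
  by case: properG => _ /existsNP[y /not_implyP[_ nGy]]; exists y.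
split=> M /andP[M0 ML].
  apply: jball_convex => //; move: ML; rewrite -ler_expR lnK ?posrE //; lra.
have r2 : (expR M - 1) ^+ 2 <= 2.
  have s0 : 0 <= Num.sqrt 2 :> R by exact: sqrtr_ge0.
  rewrite -[leRHS]sqr_sqrtr // ler_pXn2r ?nnegrE //.
    by move: ML; rewrite -ler_expR lnK ?posrE; lra.
  by rewrite subr_ge0 ltW // expR_gt1.
apply: strictly_starlikeI.
- exact: jball_open.
- exact: jball_bounded.
- exact: jball_center.
- by move=> y t cy t01; apply: jball_half_open_segment.
Qed.
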